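(* Let $n\ge1$ be an integer and let $\mu:L^\infty(\mathbb{R}^n)\to\mathbb{R}$ be a translation-invariant valuation. If $u\in L^\infty(\mathbb{R}^n)$ vanishes almost everywhere outside $B_m(H)$ for some hyperplane $H\subset\mathbb{R}^n$ and some $m>0$, then $\mu(u)=0$.
   Context: $L^\infty(\mathbb{R}^n)$ is the usual space of essentially bounded Lebesgue measurable functions $\mathbb{R}^n\to\mathbb{R}$ modulo almost everywhere equality. For a hyperplane $H\subset\mathbb{R}^n$ and $m>0$, $B_m(H):=\{x\in\mathbb{R}^n:\operatorname{dist}(x,H)<m\}$. A valuation is a map $\mu:L^\infty(\mathbb{R}^n)\to\mathbb{R}$ with $\mu(u\lor v)+\mu(u\land v)=\mu(u)+\mu(v)$ for all $u,v\in L^\infty(\mathbb{R}^n)$ (pointwise maximum and minimum) and $\mu(\mathbf{0})=0$, where $\mathbf{0}$ is the zero function. It is translation-invariant if $\mu(\mathcal{T}_tu)=\mu(u)$ for all $u\in L^\infty(\mathbb{R}^n)$ and $t\in\mathbb{R}^n$, where $\mathcal{T}_tu(x):=u(x-t)$. *)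

(* Defs.v *)
From HB Require Import structures.
From mathcomp Require Import all_boot all_order all_algebra.
From mathcomp Require Import all_classical all_reals all_analysis.
From mathcomp Require Import ess_sup_inf measurable_realfun.

Set Implicit Arguments.
Unset Strict Implicit.
Unset Printing Implicit Defensive.
Import Order.TTheory GRing.Theory Num.Theory.
Import numFieldNormedType.Exports.

Local Open Scope classical_set_scope.
Local Open Scope ring_scope.

Section lebesgue_outer_measure.
Context {R : realType} {n : nat}.
Local Open Scope ereal_scope.
Implicit Types (A : set 'rV[R]_n) (b : 'rV[R]_n * 'rV[R]_n).

Definition box b : set 'rV[R]_n :=
  [set x | forall i, (b.1 0 i <= x 0 i <= b.2 0 i)%R].

Definition box_volume b : R := (\prod_i Num.max 0 (b.2 0 i - b.1 0 i))%R.

(* In a cover, [None] stands for the empty set, so that finite covers are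
   covers too. *)
Definition obox : option ('rV[R]_n * 'rV[R]_n) -> set 'rV[R]_n :=
  oapp box set0.

Definition obox_volume (o : option ('rV[R]_n * 'rV[R]_n)) : R :=
  oapp box_volume 0%R o.

Definition box_cover A : set (nat -> option ('rV[R]_n * 'rV[R]_n)) :=
  [set F | A `<=` \bigcup_k obox (F k)].

Definition lebesgue_outer A : \bar R :=
  ereal_inf [set \sum_(k <oo) (obox_volume (F k))%:E | F in box_cover A].

Let vol_ge0 o : 0 <= (obox_volume o)%:E.
Proof.
by rewrite lee_fin; case: o => //= b; apply: prodr_ge0 => i _; rewrite le_max lexx.
Qed.

Let le_lebesgue_outer : {homo lebesgue_outer : A B / A `<=` B >-> A <= B}.
Proof.
move=> A B AB; apply/ereal_inf_le_tmp => x [F BF <-].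
by exists F => //; exact: subset_trans BF.
Qed.

Let lebesgue_outer_ge0 A : 0 <= lebesgue_outer A.
Proof. by apply: le_ereal_inf_tmp => _ [F _ <-]; exact: nneseries_ge0. Qed.

Let lebesgue_outer0 : lebesgue_outer set0 = 0.
Proof.
apply/eqP; rewrite eq_le lebesgue_outer_ge0 andbT.
apply: ereal_inf_lbound; exists (fun=> None); first exact: sub0set.
by rewrite eseries0.
Qed.

Let lebesgue_outer_sigma_subadditive : sigma_subadditive lebesgue_outer.
Proof.
move=> A; have [[i ioo]|] := pselect (exists i, lebesgue_outer (A i) = +oo).
  rewrite (eseries_pinfty _ _ ioo) ?leey// => k _.
  by rewrite -ltNye (lt_le_trans _ (lebesgue_outer_ge0 _)).
rewrite -forallNE => Aoo.
suff add2e (e : {posnum R}) :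
    lebesgue_outer (\bigcup_n A n) <=
      \sum_(i <oo) lebesgue_outer (A i) + e%:num%:E.
  by apply/lee_addgt0Pr => _/posnumP[].
rewrite (le_trans _ (epsilon_trick _ _ _))//.
pose P k (F : nat -> _) := box_cover (A k) F /\
  \sum_(j <oo) (obox_volume (F j))%:E <=
    lebesgue_outer (A k) + (e%:num / (2 ^ k.+1)%:R)%:E.
have [G PG] : {G : nat -> nat -> _ & forall k, P k (G k)}.
  apply: (@choice _ _ P) => k; rewrite /P.
  have lA : lebesgue_outer (A k) \is a fin_num.
    by rewrite ge0_fin_numE// ltey; exact/eqP/Aoo.
  have ek : (0 < e%:num / (2 ^ k.+1)%:R)%R by [].
  have [_ [F AF <-] xS] := lb_ereal_inf_adherent ek lA.
  by exists F; split => //; exact/ltW.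
pose v : nat * nat -> \bar R := fun x => (obox_volume (uncurry G x))%:E.
have v_ge0 x : 0 <= v x by exact: vol_ge0.
apply: (@le_trans _ _ (\esum_(i in setT) v i)).
  apply: ereal_inf_lbound => /=.
  have /card_esym/ppcard_eqP[f] := card_nat2.
  exists (uncurry G \o f).
    move=> t [i _ /(PG i).1[j _ Gt]].
    by exists (f^-1%FUN (i, j)) => //=; rewrite invK ?inE.
  transitivity (\sum_(k <oo) v (f k)); first by [].
  rewrite -(esum_pred_image v _ xpredT) ?[fun=> _]set_true//.
  by rewrite image_eq.
rewrite (_ : esum _ _ = \sum_(i <oo) \sum_(j <oo) v (i, j)); last first.
  pose J : nat -> set (nat * nat) := fun i => [set (i, j) | j in setT].
  rewrite (_ : setT = \bigcup_k J k); last first.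
    by rewrite predeqE => -[a b]; split => // _; exists a => //; exists b.
  rewrite esum_bigcupT //=; last first.
    apply/trivIsetP => i j _ _ ij.
    rewrite predeqE => -[k m] /=; split => //= -[] [_] _ [<-{k} _].
    by move=> [m' _] [] /esym/eqP; rewrite (negbTE ij).
  rewrite -(image_id [set: nat]) -fun_true esum_pred_image//; last first.
    by move=> k _; exact: esum_ge0.
  apply: eq_eseriesr => /= j _.
  rewrite -(esum_pred_image v (pair j) predT)//=; last first.
    by move=> ? ? _ _; exact: (@can_inj _ _ _ snd).
  by congr esum; rewrite predeqE => -[a b]; split; move=> [i _ <-]; exists i.
apply: lee_nneseries => [k _ _|k _]; first exact: nneseries_ge0.
exact: (PG k).2.
Qed.

HB.instance Definition _ := isOuterMeasure.Build R 'rV[R]_n lebesgue_outer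
  lebesgue_outer0 lebesgue_outer_ge0 le_lebesgue_outer
  lebesgue_outer_sigma_subadditive.

Let lebesgue_outer_shift_le (t : 'rV[R]_n) A :
  lebesgue_outer ((fun x => x - t)%R @^-1` A) <= lebesgue_outer A.
Proof.
apply: le_ereal_inf_tmp => _ [F AF <-]; apply: ereal_inf_lbound.
pose s b := ((b.1 + t)%R, (b.2 + t)%R).
exists (fun k => omap s (F k)).
  move=> x /= /AF[k _ Fk]; exists k => //; move: Fk.
  case: (F k) => //= b xb i; have := xb i.
  by rewrite !mxE lerBrDr lerBlDr.
apply: eq_eseriesr => k _; case: (F k) => //= b; congr EFin.
by apply: eq_bigr => i _; rewrite !mxE opprD addrACA subrr addr0.
Qed.

Lemma lebesgue_outer_shift (t : 'rV[R]_n) A :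
  lebesgue_outer ((fun x => x - t)%R @^-1` A) = lebesgue_outer A.
Proof.
apply/eqP; rewrite eq_le lebesgue_outer_shift_le/=.
rewrite -[X in X <= _](_ : lebesgue_outer
  ((fun x => x - (- t))%R @^-1` ((fun x => x - t)%R @^-1` A)) = _).
  exact: lebesgue_outer_shift_le.
congr lebesgue_outer; apply/seteqP.
by split=> x /=; rewrite opprK addrK.
Qed.

Lemma caratheodory_shift (t : 'rV[R]_n) A :
  lebesgue_outer.-caratheodory A ->
  lebesgue_outer.-caratheodory ((fun x => x - t)%R @^-1` A).
Proof.
move=> cA X; rewrite -(lebesgue_outer_shift (- t) X) cA.
rewrite -(lebesgue_outer_shift (- t) (X `&` _)).
rewrite -(lebesgue_outer_shift (- t) (X `&` ~` _)).
congr (lebesgue_outer _ + lebesgue_outer _);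
  by apply/seteqP; split => x /=; rewrite opprK addrK.
Qed.

End lebesgue_outer_measure.

Definition lebesgue_om (R : realType) (n : nat) :
  {outer_measure set 'rV[R]_n -> \bar R} := @lebesgue_outer R n.

(* R^n with the sigma-algebra of Lebesgue (Caratheodory) measurable sets. *)
Definition lebesgueType (R : realType) (n : nat) : measurableType _ :=
  caratheodory_type (lebesgue_om R n).

Definition lebesgueRn (R : realType) (n : nat) :
    {measure set (lebesgueType R n) -> \bar R} :=
  (lebesgue_om R n : set (caratheodory_type (lebesgue_om R n)) -> \bar R).

(* The quotient by equality a.e. of the essentially bounded measurable
   functions; for [u : Linfty R n], [u x] is the value at [x] of a chosen
   representative, hence meaningful only under [\ae]. *)
Definition Linfty (R : realType) (n : nat) :=
  LspaceType (lebesgueRn R n) (leey 1).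

Section Linfty_operations.
Context {R : realType} {n : nat}.
Local Notation T := (lebesgueType R n).
Local Notation mu := (lebesgueRn R n).
Implicit Types (f g : T -> R) (u v : Linfty R n) (t : 'rV[R]_n).

Lemma finite_norm_yP f : finite_norm mu +oo f <->
  exists M : R, \forall x \ae mu, `|f x| <= M.
Proof.
rewrite /finite_norm unlock; case: ifPn => [_|mu0]; last first.
  split => // _; exists 0; apply: measure0_ae.
  by apply/eqP; rewrite eq_le measure_ge0 andbT leNgt.
split => [/ess_supr_bounded|[M fM]]; first by [].
apply: (@le_lt_trans _ _ M%:E); last exact: ltry.
by apply/ess_supP; apply: filterS fM => x; rewrite /= lee_fin.
Qed.

Section representative.
Variables (f : T -> R) (mf : measurable_fun setT f)
  (bf : exists M : R, \forall x \ae mu, `|f x| <= M).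

Let f_mfun : {mfun T >-> measurableTypeR R} :=
  HB.pack f (@isMeasurableFun.Build _ _ T (measurableTypeR R) f mf).

Let f_class : {mfun_ mu, T >-> measurableTypeR R} := (\pi f_mfun)%qT.

Let f_classE : f_class = f %[ae mu].
Proof.
have : (repr f_class == f_mfun %[mod {mfun_ mu, T >-> measurableTypeR R}])%qT.
  by rewrite reprK.
by rewrite eqmodE => /asboolP.
Qed.

Let f_class_finite : finite_norm mu +oo f_class.
Proof.
have [M fM] := bf; apply/finite_norm_yP; exists M.
by apply: filterS2 f_classE fM => x /= ->.
Qed.

Definition Linfty_of : Linfty R n :=
  HB.pack f_class
    (@isFinLebesgue.Build _ T R mu +oo%E (leey 1) f_class f_class_finite).

Lemma Linfty_ofE : Linfty_of = f %[ae mu].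
Proof. exact: f_classE. Qed.

End representative.

Lemma Linfty_measurable u : measurable_fun setT (u : T -> R).
Proof.
exact: (@measurable_funPT _ _ T (measurableTypeR R)
  (repr (u : {mfun_ mu, _ >-> _}))).
Qed.

Lemma Linfty_bounded u : exists M : R, \forall x \ae mu, `|u x| <= M.
Proof. by apply/finite_norm_yP; exact: Lebesgue_finite. Qed.

Lemma Linfty_eqP u v : u = v <-> u = v %[ae mu].
Proof.
split => [-> //|uv]; first exact: ae_eq_refl.
have : (u : {mfun_ mu, _ >-> _}) = v.
  rewrite -[LHS]reprK -[RHS]reprK; apply/eqP.
  by rewrite eqmodE; exact/asboolP.
case: u v {uv} => u [[uP]] [v [[vP]]] /= uv.
by rewrite uv in uP *; rewrite (Prop_irrelevance uP vP).
Qed.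

Lemma lebesgueRn_shift_measurable t :
  measurable_fun setT ((fun x => x - t) : T -> T).
Proof.
move=> _ A mA; rewrite setTI; exact: caratheodory_shift.
Qed.

Lemma lebesgueRn_shift_ae t (P : T -> Prop) :
  (\forall x \ae mu, P x) -> \forall x \ae mu, P (x - t : T).
Proof.
move=> [N [mN N0 PN]]; exists ((fun x : T => x - t : T) @^-1` N); split.
- by rewrite -[X in measurable X]setTI; exact: lebesgueRn_shift_measurable.
- by rewrite -N0; exact: lebesgue_outer_shift.
- by move=> x /= Px; apply: PN.
Qed.

Lemma Linfty0_subproof : exists M : R, \forall x \ae mu, `|cst 0 x : R| <= M.
Proof. by exists 0; apply: aeW => x; rewrite normr0. Qed.

Definition Linfty0 : Linfty R n :=
  Linfty_of (measurable_cst (0 : R)) Linfty0_subproof.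

Lemma Linfty_max_subproof u v :
  exists M : R, \forall x \ae mu, `|Num.max (u x) (v x)| <= M.
Proof.
have [M uM] := Linfty_bounded u; have [N vN] := Linfty_bounded v.
exists (Num.max M N); apply: filterS2 uM vN => x uM vN.
by rewrite le_max; case: (leP (u x)) => _; apply/orP; [right|left].
Qed.

Definition Linfty_max u v : Linfty R n :=
  Linfty_of (measurable_maxr (Linfty_measurable u) (Linfty_measurable v))
    (Linfty_max_subproof u v).

Lemma Linfty_min_subproof u v :
  exists M : R, \forall x \ae mu, `|Num.min (u x) (v x)| <= M.
Proof.
have [M uM] := Linfty_bounded u; have [N vN] := Linfty_bounded v.
exists (Num.max M N); apply: filterS2 uM vN => x uM vN.
by rewrite le_max; case: (leP (u x)) => _; apply/orP; [left|right].
Qed.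

Definition Linfty_min u v : Linfty R n :=
  Linfty_of (measurable_minr (Linfty_measurable u) (Linfty_measurable v))
    (Linfty_min_subproof u v).

Lemma Linfty_shift_measurable_subproof t u :
  measurable_fun setT (fun x : T => u (x - t) : R).
Proof.
exact: (measurableT_comp (Linfty_measurable u) (lebesgueRn_shift_measurable t)).
Qed.

Lemma Linfty_shift_subproof t u :
  exists M : R, \forall x \ae mu, `|u (x - t)| <= M.
Proof.
have [M uM] := Linfty_bounded u.
exists M; exact: lebesgueRn_shift_ae uM.
Qed.

Definition Linfty_shift t u : Linfty R n :=
  Linfty_of (Linfty_shift_measurable_subproof t u) (Linfty_shift_subproof t u).

Lemma Linfty0E : Linfty0 = cst 0 %[ae mu].
Proof. exact: Linfty_ofE. Qed.

Lemma Linfty_maxE u v : Linfty_max u v = (u : T -> R) \max v %[ae mu].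
Proof. exact: Linfty_ofE. Qed.

Lemma Linfty_minE u v : Linfty_min u v = (u : T -> R) \min v %[ae mu].
Proof. exact: Linfty_ofE. Qed.

Lemma Linfty_shiftE t u : Linfty_shift t u = (fun x => u (x - t)) %[ae mu].
Proof. exact: Linfty_ofE. Qed.

Definition valuation (m : Linfty R n -> R) :=
  (forall u v, m (Linfty_max u v) + m (Linfty_min u v) = m u + m v) /\
  m Linfty0 = 0.

Definition translation_invariant (m : Linfty R n -> R) :=
  forall u t, m (Linfty_shift t u) = m u.

End Linfty_operations.

Section hyperplane.
Context {R : realType} {n : nat}.
Implicit Types (x a : 'rV[R]_n) (H : set 'rV[R]_n).

(* The library norm on ['rV[R]_n] is the sup norm. *)
Definition euclidean_norm x : R := Num.sqrt (\sum_i x 0 i ^+ 2).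

Definition is_hyperplane H := exists a (c : R),
  a != 0 /\ H = [set x | \sum_i a 0 i * x 0 i = c].

Definition dist x H : R := inf [set euclidean_norm (x - y) | y in H].

Definition slab (m : R) H : set 'rV[R]_n := [set x | dist x H < m].

End hyperplane.

(* Main.v *)
Require Import Defs.
From mathcomp Require Import all_boot all_order all_algebra.
From mathcomp Require Import all_classical all_reals all_analysis.
From mathcomp Require Import measurable_realfun lra.
Import Order.TTheory GRing.Theory Num.Theory.
Import numFieldNormedType.Exports.
Local Open Scope classical_set_scope.
Local Open Scope ring_scope.

(** Choose [t] normal to the hyperplane and so long that the slab is disjoint
    from all its translates by positive multiples of [t]. If [u >= 0], then
    [w x := sup_k u (x - k t)] is bounded, [u \max T_t w = w] and
    [u \min T_t w = 0], so the valuation property and translation invariance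
    give [mu w = mu u + mu w], that is, [mu u = 0]. The general case follows by
    splitting [u] into [u \max 0] and [u \min 0], the latter being treated by
    applying the nonnegative case to the valuation [v |-> mu (- v)]. *)

(** * Pointwise supremum of the forward translates of a bounded function *)

Section sups_translates.
Context {R : realType} {V : zmodType}.
Variables (g : V -> R) (t : V) (B : R).
Hypothesis gB : forall x, g x <= B.

Definition translates (k : nat) (x : V) : R := g (x - t *+ k).

(** [sups] at index 0 is the supremum over all [k]; in this form [measurable_fun_sups] applies to
    it. *)
Definition sup_translates (x : V) : R := sups (translates ^~ x) 0.

Lemma translates_has_ubound x : has_ubound (range (translates ^~ x)).
Proof. by exists B => _ [k _ <-]; exact: gB. Qed.

Lemma sup_translates_ub k x : translates k x <= sup_translates x.
Proof.
apply: ub_le_sup; last by exists k.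
exact/has_ubound_sdrop/translates_has_ubound.
Qed.

Lemma sup_translates_le x y :
  (forall k, translates k x <= y) -> sup_translates x <= y.
Proof.
move=> gy; apply: ge_sup; first by exists (translates 0 x), 0%N.
by move=> _ [k _ <-]; exact: gy.
Qed.

Lemma translates0 x : translates 0 x = g x.
Proof. by rewrite /translates mulr0n subr0. Qed.

Lemma translatesS k x : translates k.+1 x = translates k (x - t).
Proof. by rewrite /translates mulrS opprD addrA. Qed.

(** Splitting off the term [k = 0] leaves the terms [k.+1] at [x], which are the terms [k] at
    [x - t]. *)
Lemma sup_translatesE x :
  sup_translates x = Num.max (g x) (sup_translates (x - t)).
Proof.
apply/eqP; rewrite eq_le; apply/andP; split.
  apply: sup_translates_le => -[|k]; rewrite le_max ?translates0 ?lexx//.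
  by rewrite translatesS sup_translates_ub orbT.
rewrite ge_max -{1}translates0 sup_translates_ub/=.
by apply: sup_translates_le => k; rewrite -translatesS sup_translates_ub.
Qed.

End sups_translates.

(** * Almost everywhere calculus in [Linfty] and duality under negation *)

Section valuations.
Context {R : realType} {n : nat}.
Local Notation T := (lebesgueType R n).
Local Notation leb := (lebesgueRn R n).
Implicit Types (u v : Linfty R n) (t : 'rV[R]_n) (mu : Linfty R n -> R).

#[local] Instance ae_lebesgueRn_filter :
  Filter (nbhs (almost_everywhere leb)) := ae_filter_ringOfSetsType leb.

Lemma Linfty_opp_subproof u : exists M : R, \forall x \ae leb, `|- u x| <= M.
Proof.
have [M uM] := Linfty_bounded u; exists M.
by apply: filterS uM => x; rewrite normrN.
Qed.

Definition Linfty_opp u : Linfty R n :=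
  Linfty_of (measurable_funN (Linfty_measurable u)) (Linfty_opp_subproof u).

Lemma Linfty_oppE u : Linfty_opp u = (fun x => - u x) %[ae leb].
Proof. exact: Linfty_ofE. Qed.

(** Equality under [%[ae leb]] carries a premise of membership in [setT]. This lemma and the next
    four discharge it, so that [near] can rewrite with the pointwise formulas. *)
Lemma ae_Linfty_opp u : \forall x \ae leb, Linfty_opp u x = - u x.
Proof. by apply: filterS (Linfty_oppE u) => x; exact. Qed.

Lemma ae_Linfty0 : \forall x \ae leb, @Linfty0 R n x = 0.
Proof. by apply: filterS (@Linfty0E R n) => x; exact. Qed.

Lemma ae_Linfty_max u v :
  \forall x \ae leb, Linfty_max u v x = Num.max (u x) (v x).
Proof. by apply: filterS (Linfty_maxE u v) => x; exact. Qed.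

Lemma ae_Linfty_min u v :
  \forall x \ae leb, Linfty_min u v x = Num.min (u x) (v x).
Proof. by apply: filterS (Linfty_minE u v) => x; exact. Qed.

Lemma ae_Linfty_shift t u :
  \forall x \ae leb, Linfty_shift t u x = u (x - t).
Proof. by apply: filterS (Linfty_shiftE t u) => x; exact. Qed.

Lemma Linfty_oppK u : Linfty_opp (Linfty_opp u) = u.
Proof.
apply/Linfty_eqP; near=> x => _.
rewrite (near (ae_Linfty_opp (Linfty_opp u)) x)//.
by rewrite (near (ae_Linfty_opp u) x)// opprK.
Unshelve. all: by end_near. Qed.

Lemma Linfty_opp0 : Linfty_opp Linfty0 = Linfty0.
Proof.
apply/Linfty_eqP; near=> x => _.
rewrite (near (ae_Linfty_opp Linfty0) x)//.
by rewrite (near ae_Linfty0 x)// oppr0.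
Unshelve. all: by end_near. Qed.

Lemma Linfty_opp_max u v :
  Linfty_opp (Linfty_max u v) = Linfty_min (Linfty_opp u) (Linfty_opp v).
Proof.
apply/Linfty_eqP; near=> x => _.
rewrite (near (ae_Linfty_opp (Linfty_max u v)) x)//.
rewrite (near (ae_Linfty_min (Linfty_opp u) (Linfty_opp v)) x)//.
rewrite (near (ae_Linfty_max u v) x)// oppr_max.
by rewrite (near (ae_Linfty_opp u) x)// (near (ae_Linfty_opp v) x).
Unshelve. all: by end_near. Qed.

Lemma Linfty_opp_min u v :
  Linfty_opp (Linfty_min u v) = Linfty_max (Linfty_opp u) (Linfty_opp v).
Proof.
by rewrite -[RHS]Linfty_oppK Linfty_opp_max !Linfty_oppK.
Qed.

Lemma Linfty_opp_shift t u :
  Linfty_opp (Linfty_shift t u) = Linfty_shift t (Linfty_opp u).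
Proof.
apply/Linfty_eqP; near=> x => _.
rewrite (near (ae_Linfty_opp (Linfty_shift t u)) x)//.
rewrite (near (ae_Linfty_shift t (Linfty_opp u)) x)//.
rewrite (near (ae_Linfty_shift t u) x)//.
(* The formula for [Linfty_opp u] is needed at [x - t]; it holds there for almost every [x] because
   translations preserve null sets. *)
by rewrite (near (lebesgueRn_shift_ae t (ae_Linfty_opp u)) x).
Unshelve. all: by end_near. Qed.

(** Negation exchanges maximum and minimum, so the modular identity only has its two left-hand terms
    swapped. *)
Lemma valuation_opp mu : valuation mu -> valuation (mu \o Linfty_opp).
Proof.
move=> [mu_mod mu0]; split=> [u v|] /=; last by rewrite Linfty_opp0.
by rewrite Linfty_opp_max Linfty_opp_min addrC mu_mod.
Qed.

Lemma translation_invariant_opp mu :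
  translation_invariant mu -> translation_invariant (mu \o Linfty_opp).
Proof. by move=> mu_inv u t /=; rewrite Linfty_opp_shift mu_inv. Qed.

(** * Functions supported in a set that is disjoint from its further translates *)

Section wandering.
Variables (S : set 'rV[R]_n) (t : 'rV[R]_n).
Hypothesis wander : forall x k, S x -> ~ S (x - t *+ k.+1).

Lemma nonneg_decomposition u :
  (\forall x \ae leb, 0 <= u x) -> (\forall x \ae leb, ~ S x -> u x = 0) ->
  exists w : Linfty R n, Linfty_max u (Linfty_shift t w) = w /\
    Linfty_min u (Linfty_shift t w) = Linfty0.
Proof.
move=> u_ge0 uS; have [M uM] := Linfty_bounded u.
(* The bounds on [u] hold only almost everywhere, whereas the supremum is taken pointwise;
   truncation gives a representative bounded at every point. The sign of [M] is unknown, hence the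
   bound [Num.max 0 M]. *)
pose g (x : 'rV[R]_n) : R := Num.max 0 (Num.min M (u x)).
have g_ge0 x : 0 <= g x by rewrite /g le_max lexx.
have gM x : g x <= Num.max 0 M.
  by rewrite /g ge_max le_max lexx le_max (ge_min M) lexx orbT.
have gu : \forall x \ae leb, g x = u x.
  apply: filterS2 u_ge0 uM => x u0 uM.
  by rewrite /g min_r ?max_r// (le_trans (ler_norm _)).
have mg : measurable_fun setT (g : T -> R).
  apply: measurable_maxr; first exact: measurable_cst.
  by apply: measurable_minr; [exact: measurable_cst|exact: Linfty_measurable].
have w_ge0 x : 0 <= sup_translates g t x.
  by apply: le_trans (sup_translates_ub g t _ gM 0 x); exact: g_ge0.
have mw : measurable_fun setT (sup_translates g t : T -> R).
  apply: measurable_fun_sups => [x _|k].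
    exact: (translates_has_ubound _ _ _ gM).
  exact: (measurableT_comp mg (lebesgueRn_shift_measurable (t *+ k))).
have bw : exists B : R, \forall x \ae leb, `|sup_translates g t x| <= B.
  exists (Num.max 0 M); apply: aeW => x.
  by rewrite ger0_norm//; apply: sup_translates_le => k; exact: gM.
have gS0 : \forall x \ae leb, ~ S x -> g x = 0.
  by near=> x => Sx; rewrite (near gu x)// (near uS x).
(* A countable union of null sets is null, so one exceptional set serves all [k]. *)
have gS : \forall x \ae leb, forall k, ~ S (x - t *+ k) -> g (x - t *+ k) = 0.
  by apply: ae_foralln => k; exact: lebesgueRn_shift_ae (t *+ k) _ gS0.
exists (Linfty_of mw bw); set w := Linfty_of mw bw.
have ww : \forall x \ae leb, w x = sup_translates g t x.
  by apply: filterS (Linfty_ofE mw bw) => x; exact.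
have wE : \forall x \ae leb, Linfty_shift t w x = sup_translates g t (x - t).
  near=> x; rewrite (near (ae_Linfty_shift t w) x)//.
  by rewrite (near (lebesgueRn_shift_ae t ww) x).
split; apply/Linfty_eqP; near=> x => _.
  rewrite (near (ae_Linfty_max u (Linfty_shift t w)) x)//.
  rewrite (near ww x)// (near wE x)//.
  by rewrite (sup_translatesE _ _ _ gM x) (near gu x).
rewrite (near (ae_Linfty_min u (Linfty_shift t w)) x)//.
rewrite (near ae_Linfty0 x)// (near wE x)// -(near gu x)//.
have gSx := near gS x.
(* Outside [S] the value [g x] is zero and the shifted supremum is nonnegative; inside [S] every
   term of the shifted supremum vanishes. *)
have [Sx|Sx] := pselect (S x); last first.
  by have := gSx _ 0%N; rewrite mulr0n subr0 => ->//; rewrite min_l.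
suff -> : sup_translates g t (x - t) = 0 by rewrite min_r.
apply/eqP; rewrite eq_le w_ge0 andbT; apply: sup_translates_le => k.
(* The supremum at [x - t] starts from the translate by [t] itself, which matches the [k.+1] in
   [wander]. *)
by rewrite -translatesS /translates gSx//; exact: wander.
Unshelve. all: by end_near. Qed.

Lemma valuation_nonneg_eq0 mu u : valuation mu -> translation_invariant mu ->
  (\forall x \ae leb, 0 <= u x) -> (\forall x \ae leb, ~ S x -> u x = 0) ->
  mu u = 0.
Proof.
move=> [mu_mod mu0] mu_inv u_ge0 uS.
have [w [maxE minE]] := nonneg_decomposition _ u_ge0 uS.
have := mu_mod u (Linfty_shift t w).
rewrite maxE minE mu0 mu_inv addr0 => mu_w.
by apply: (addIr (mu w)); rewrite -mu_w add0r.
Qed.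

Lemma valuation_eq0 mu u : valuation mu -> translation_invariant mu ->
  (\forall x \ae leb, ~ S x -> u x = 0) -> mu u = 0.
Proof.
move=> mu_val mu_inv uS; have [mu_mod mu0] := mu_val.
(* The modular identity for [u] and zero writes [mu u] as the sum of the values at the positive and
   the nonpositive part. *)
have := mu_mod u Linfty0; rewrite mu0 addr0 => <-.
have -> : mu (Linfty_max u Linfty0) = 0.
  apply: valuation_nonneg_eq0 => //; near=> x.
    rewrite (near (ae_Linfty_max u Linfty0) x)// (near ae_Linfty0 x)//.
    by rewrite le_max lexx orbT.
  move=> Sx; rewrite (near (ae_Linfty_max u Linfty0) x)//.
  by rewrite (near ae_Linfty0 x)// (near uS x)// maxxx.
rewrite add0r -[Linfty_min _ _]Linfty_oppK.
apply: (@valuation_nonneg_eq0 (mu \o Linfty_opp)).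
- exact: valuation_opp.
- exact: translation_invariant_opp.
- near=> x; rewrite (near (ae_Linfty_opp (Linfty_min u Linfty0)) x)//.
  rewrite (near (ae_Linfty_min u Linfty0) x)// (near ae_Linfty0 x)//.
  by rewrite oppr_ge0 ge_min lexx orbT.
- near=> x => Sx; rewrite (near (ae_Linfty_opp (Linfty_min u Linfty0)) x)//.
  rewrite (near (ae_Linfty_min u Linfty0) x)// (near ae_Linfty0 x)//.
  by rewrite (near uS x)// minxx oppr0.
Unshelve. all: by end_near. Qed.

End wandering.

End valuations.

(** * Slabs around hyperplanes are wandering sets *)

Section hyperplanes.
Context {R : realType} {n : nat}.
Implicit Types a x y : 'rV[R]_n.

Lemma normr_le_euclidean x i : `|x 0 i| <= euclidean_norm x.
Proof.
rewrite -sqrtr_sqr ler_sqrt ?sumr_ge0// => [|j _]; last exact: sqr_ge0.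
by rewrite (bigD1 i)//= lerDl sumr_ge0// => j _; exact: sqr_ge0.
Qed.

Lemma sqr_norm_gt0 a : a != 0 -> 0 < \sum_i a 0 i ^+ 2.
Proof.
move=> a0; rewrite lt_neqAle sumr_ge0 ?andbT => [|i _]; last exact: sqr_ge0.
apply: contraNneq a0 => /esym/eqP; rewrite psumr_eq0 => [/allP a0|i _]; last first.
  exact: sqr_ge0.
apply/eqP/rowP => i; rewrite mxE; apply/eqP.
by rewrite -sqrf_eq0; exact: (a0 i (mem_index_enum i)).
Qed.

(** Some [y] in the hyperplane has distance less than [m] from [x]; each coordinate of [x - y] is
    then at most [m] in absolute value, and the triangle inequality bounds the linear form. This is
    cruder than Cauchy-Schwarz but sufficient. *)
Lemma slab_linear_bound a (c m : R) x : a != 0 ->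
  slab m [set y | \sum_i a 0 i * y 0 i = c] x ->
  `|\sum_i a 0 i * x 0 i - c| <= m * \sum_i `|a 0 i|.
Proof.
move=> a0 /inf_lt[|_ [y yc <-] xym].
  (* The infimum must range over a nonempty set; the witness is the foot of the perpendicular from
     the origin to the hyperplane. *)
  apply/image_nonempty; exists ((c / \sum_i a 0 i ^+ 2) *: a) => /=.
  under eq_bigr do rewrite mxE mulrCA -expr2.
  by rewrite -mulr_sumr divfK// gt_eqF// sqr_norm_gt0.
rewrite -{}yc -sumrB mulr_sumr; apply: le_trans (ler_norm_sum _ _ _) _.
apply: ler_sum => i _; rewrite -mulrBr normrM mulrC ler_wpM2r//.
have := normr_le_euclidean (x - y) i; rewrite !mxE => /le_trans; apply.
exact: ltW.
Qed.

Lemma hyperplane_wandering (H : set 'rV[R]_n) (m : R) : is_hyperplane H ->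
  0 < m -> exists t, forall x k, slab m H x -> ~ slab m H (x - t *+ k.+1).
Proof.
move=> [a [c [a0 ->]]] m0.
have N0 := sqr_norm_gt0 _ a0; set N := \sum_i _ in N0.
(* Division by [N], the squared length of [a], makes the linear form equal to [s] at [t]; this [s]
   exceeds by one the width of the range allowed by [slab_linear_bound]. *)
pose s := 2 * (m * \sum_i `|a 0 i|) + 1; exists ((s / N) *: a) => x k.
move=> /(slab_linear_bound _ _ _ _ a0) xm /(slab_linear_bound _ _ _ _ a0).
have -> : \sum_i a 0 i * (x - ((s / N) *: a) *+ k.+1) 0 i =
    \sum_i a 0 i * x 0 i - s *+ k.+1.
  under eq_bigr do rewrite scalerMnl !mxE mulrBr mulrCA -expr2.
  by rewrite sumrB -mulr_sumr mulrnAl divfK// gt_eqF.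
have K0 : 0 <= m * \sum_i `|a 0 i| by rewrite mulr_ge0 ?(ltW m0)// sumr_ge0.
(* If both points were in the slab, their values of the form would differ by at most [s - 1], but
   they differ by [s *+ k.+1], which is at least [s]. *)
have sk : s <= s *+ k.+1 by rewrite mulrS lerDl mulrn_wge0// /s; lra.
by move: xm sk; rewrite /s !ler_norml => /andP[? ?] ? /andP[? ?]; lra.
Qed.

End hyperplanes.

Theorem proposition9p1 (R : realType) (n : nat) (hn : (1 <= n)%N)
    (mu : Linfty R n -> R) (hmu : valuation mu)
    (hinv : translation_invariant mu)
    (u : Linfty R n) (H : set 'rV[R]_n) (m : R)
    (hH : is_hyperplane H) (hm : 0 < m)
    (hu : \forall x \ae lebesgueRn R n, ~ slab m H x -> u x = 0) :
  mu u = 0.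
Proof.
have [t wander] := hyperplane_wandering _ _ hH hm.
exact: (valuation_eq0 _ _ wander).
Qed.
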